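(* We have $|\mathcal{M}(1)/\!\sim_{cr,2}|=1$ and $|\mathcal{M}(n)/\!\sim_{cr,2}|=2$ for $n\ge 2$; for $n\ge 2$ the two classes of $\sim_{cr,2}$ have $((2n-1)!!+1)/2$ and $((2n-1)!!-1)/2$ elements. Moreover $|\mathcal{M}(1)/\!\sim_{ne,2}|=1$, $|\mathcal{M}(2)/\!\sim_{ne,2}|=3$, and $|\mathcal{M}(n)/\!\sim_{ne,2}|=2n$ for $n\ge 3$.
   Context: A matching on $[2n]$ is a partition of $[2n]$ into $n$ two-element blocks (edges); $\mathcal{M}(n)$ is the set of such matchings, of cardinality $(2n-1)!!=1\cdot3\cdots(2n-1)$. Edges $A,B$ cross if $\min A<\min B<\max A<\max B$ or vice versa, and are nested if $\min A<\min B<\max B<\max A$ or vice versa; $cr(M),ne(M)$ count crossing and nested pairs, and $cr_2(M),ne_2(M)\in\{0,1\}$ are their residues mod 2. For $M\in\mathcal{M}(m)$, its children are the matchings obtained by choosing $x\in\{2,\dots,2m+2\}$, relabeling the vertices of $M$ order-preservingly by $\{2,\dots,2m+2\}\setminus\{x\}$ and adding the edge $\{1,x\}$. $\mathcal{T}(M,0)=\{M\}$ and $\mathcal{T}(M,l+1)$ is the set of children of members of $\mathcal{T}(M,l)$. $M\sim_{cr,2}N$ means the multisets $\{cr_2(P):P\in\mathcal{T}(M,l)\}$ and $\{cr_2(P):P\in\mathcal{T}(N,l)\}$ coincide for every $l\ge 0$; $\sim_{ne,2}$ is defined likewise with $ne_2$. *)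

(* Defs.v *)
From mathcomp Require Import all_boot.
From mathcomp Require Import boolp.

Set Implicit Arguments.
Unset Strict Implicit.
Unset Printing Implicit Defensive.

(* The vertex set [2n] = {1, ..., 2n} is 'I_(n.*2), vertex v being v - 1. *)
Notation edge_set n := {set {set 'I_(n.*2)}}.

(* That there are n blocks follows from #|'I_(n.*2)| = 2n. *)
Definition matchings n : {set edge_set n} :=
  [set M : edge_set n |
    partition M [set: 'I_(n.*2)] && [forall B in M, #|B| == 2]].

(* The default value k is only reached on the empty set. *)
Definition emin k (A : {set 'I_k}) : nat := \big[minn/k]_(i in A) i.
Definition emax k (A : {set 'I_k}) : nat := \max_(i in A) i.

Definition crossing k (A B : {set 'I_k}) : bool :=
  [&& emin A < emin B, emin B < emax A & emax A < emax B]
  || [&& emin B < emin A, emin A < emax B & emax B < emax A].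

Definition nesting k (A B : {set 'I_k}) : bool :=
  [&& emin A < emin B, emin B < emax B & emax B < emax A]
  || [&& emin B < emin A, emin A < emax A & emax A < emax B].

(* Unordered pairs of edges are counted. *)
Definition cr n (M : edge_set n) : nat :=
  #|[set [set A; B] | A in M, B in M & crossing A B]|.
Definition ne n (M : edge_set n) : nat :=
  #|[set [set A; B] | A in M, B in M & nesting A B]|.

Definition cr2 n (M : edge_set n) : nat := cr M %% 2.
Definition ne2 n (M : edge_set n) : nat := ne M %% 2.

(* The partner x of the new first vertex is lift ord0 y;
   lift ord0 \o lift y is the increasing bijection from 'I_(m.*2) onto
   'I_(m.*2.+2) minus ord0 and x. *)
Definition child m (M : edge_set m) (y : 'I_(m.*2.+1)) : edge_set m.+1 :=
  let relabel (i : 'I_(m.*2)) : 'I_(m.*2.+2) := lift ord0 (lift y i) in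
  let new_edge : {set 'I_(m.*2.+2)} := [set ord0; lift ord0 y] in
  new_edge |: [set relabel @: (B : {set 'I_(m.*2)}) | B in M].

Definition children m (M : edge_set m) : {set edge_set m.+1} :=
  [set child M y | y : 'I_(m.*2.+1)].

Fixpoint descendants m (M : edge_set m) l : {set edge_set (l + m)} :=
  if l is l'.+1 then \bigcup_(N in descendants M l') children N else [set M].

(* Equality of finite multisets is perm_eq of enumerations. *)
Definition stat_equiv (st : forall k, edge_set k -> nat) m
    (M N : edge_set m) : Prop :=
  forall l, perm_eq [seq st (l + m) P | P in descendants M l]
                    [seq st (l + m) P | P in descendants N l].

Definition cr2_equiv m (M N : edge_set m) : Prop := stat_equiv cr2 M N.
Definition ne2_equiv m (M N : edge_set m) : Prop := stat_equiv ne2 M N.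

Definition cr2_classes n : {set {set edge_set n}} :=
  equivalence_partition (fun M N => `[< cr2_equiv M N >]) (matchings n).
Definition ne2_classes n : {set {set edge_set n}} :=
  equivalence_partition (fun M N => `[< ne2_equiv M N >]) (matchings n).

(* (2n-1)!! = 1 * 3 * ... * (2n-1) *)
Definition odd_dfact n : nat := \prod_(i < n) (2 * i + 1).

(* Main.v *)
Require Import Defs.
From mathcomp Require Import all_boot.
From mathcomp Require Import boolp.
From mathcomp Require Import all_algebra zify ring.

(** Let M be a matching with m edges.  Its children are indexed by the number
    y of vertices of M that precede the partner of the new first vertex.  The
    new edge crosses the edges with exactly one end among the first y vertices;
    the number of these has the parity of y.  Hence the signed sum of
    [(-1)^cr] over every generation of descendants of M is [(-1)^(cr M)], and
    the classes of [~_(cr,2)] are given by the parity of [cr].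

    For nestings, let [h y] be the number of edges inside the first y vertices
    and [s y = (-1)^(h y)], for [0 <= y <= 2m].  Child y has [ne M + h y]
    nestings and sign sequence [1, s 0, .., s y, - s y, .., - s (2m)].
    With [S] the sum of the signs of M, the signed sum of [(-1)^ne] over the
    first generation is [(-1)^(ne M) S], and a symmetric double sum cancels to
    show that the second generation, hence every later one, gives the same.
    So the class of M is the pair of the parity of [ne M] and the number of
    minus signs.  A sign sequence of length 2m + 1 starts with two plus signs
    and has m sign changes, which leaves m possible numbers of minus signs; for
    [m >= 3] each of them occurs with both parities. *)

Set Implicit Arguments.
Unset Strict Implicit.
Unset Printing Implicit Defensive.

(** * Counting related pairs of edges *)

Section PairCount.
Variables T U : finType.

(** [cr] and [ne] are instances of this by conversion, so the effect of adding an edge is worked out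
    once, for an arbitrary relation. *)
Definition pair_count (V : finType) (r : rel V) (M : {set V}) : nat :=
  #|[set [set A; B] | A in M, B in M & r A B]|.

Lemma pair_count_imset (r : rel T) (r' : rel U) (f : T -> U) (M : {set T}) :
  injective f -> {in M &, forall A B, r' (f A) (f B) = r A B} ->
  pair_count r' (f @: M) = pair_count r M.
Proof.
move=> f_inj rE; rewrite /pair_count.
rewrite -[RHS](card_imset _ (imset_inj f_inj)); apply: eq_card => X.
apply/imset2P/imsetP.
- case=> A1 B1 /imsetP[A MA ->{A1}]; rewrite inE => /andP[/imsetP[B MB ->{B1}]].
  rewrite rE // => rAB ->; exists [set A; B]; last by rewrite imsetU1 imset_set1.
  by apply: imset2_f => //; rewrite inE MB.
- case=> Y /imset2P[A B MA]; rewrite inE => /andP[MB rAB] -> ->.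
  exists (f A) (f B); rewrite ?imset_f ?inE ?imset_f ?rE //.
  by rewrite imsetU1 imset_set1.
Qed.

(** The new pairs are those containing [a]. Irreflexivity rules out [a] paired with itself;
    [a \notin M] makes [B] recoverable from [[set a; B]] and keeps old and new pairs apart. *)
Lemma pair_count_setU1 (r : rel T) (a : T) (M : {set T}) :
  symmetric r -> irreflexive r -> a \notin M ->
  pair_count r (a |: M) = pair_count r M + #|[set B in M | r a B]|.
Proof.
move=> rC rI aM; rewrite /pair_count.
set P := [set [set A; B] | A in M, B in M & r A B].
set Q := [set B in M | r a B].
have injQ : {in Q &, injective (fun B => [set a; B])}.
  move=> B C; rewrite !inE => /andP[MB _] _ eqBC.
  have: B \in [set a; C] by rewrite -eqBC set22.
  case/set2P=> // eqB; by rewrite -eqB MB in aM.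
rewrite -(card_in_imset injQ) -cardsUI.
have -> : P :&: [set [set a; B] | B in Q] = set0.
  apply/setP=> X; rewrite !inE; apply/negbTE/negP=> /andP[/imset2P[A B MA]].
  rewrite inE => /andP[MB _] -> /imsetP[C _ eqX].
  have: a \in [set A; B] by rewrite eqX set21.
  by case/set2P=> eqa; rewrite eqa ?MA ?MB in aM.
rewrite cards0 addn0; apply: eq_card => X; rewrite in_setU.
apply/imset2P/orP.
- case=> A B /setU1P[-> | MA]; rewrite inE => /andP[/setU1P[-> | MB]].
  + by rewrite rI.
  + move=> rAB ->; right; apply/imsetP; exists B; by rewrite ?inE ?MB.
  + rewrite rC => rAB ->; right; apply/imsetP; exists A; rewrite ?inE ?MA //.
    exact: setUC.
  + by move=> rAB ->; left; apply: imset2_f; rewrite // inE MB.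
- case=> [/imset2P[A B MA] | /imsetP[B]].
  + rewrite inE => /andP[MB rAB] ->.
    by exists A B; rewrite ?inE ?MA ?MB ?orbT.
  + rewrite inE => /andP[MB rAB] ->.
    by exists a B; rewrite ?inE ?eqxx ?MB ?orbT.
Qed.

End PairCount.

Lemma pair_count_set0 (T : finType) (r : rel T) : pair_count r set0 = 0.
Proof.
apply: eq_card0 => X; apply/negP=> /imset2P[A B].
by rewrite in_set0.
Qed.

(** * Crossing, nesting and the ends of an edge *)

Lemma crossing_sym k : symmetric (@crossing k).
Proof. by move=> A B; rewrite /crossing orbC. Qed.

Lemma nesting_sym k : symmetric (@nesting k).
Proof. by move=> A B; rewrite /nesting orbC. Qed.

Lemma crossing_irr k : irreflexive (@crossing k).
Proof. by move=> A; rewrite /crossing ltnn. Qed.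

Lemma nesting_irr k : irreflexive (@nesting k).
Proof. by move=> A; rewrite /nesting ltnn. Qed.

Lemma emin_set2 k (a b : 'I_k) : a < b -> emin [set a; b] = a.
Proof.
move=> ltab; rewrite /emin; apply/eqP; rewrite eqn_leq; apply/andP; split.
- have: a \in index_enum 'I_k by rewrite mem_index_enum.
  (* [minn] has no neutral element on [nat], so this bound goes by induction over the enumeration,
     until [a] itself is met. *)
  elim: (index_enum _) => // c s IHs; rewrite inE big_cons.
  have [<- _ | _ /= /IHs IH] := eqVneq a c; first by rewrite set21 geq_minl.
  by case: ifP => // _; apply: leq_trans (geq_minr _ _) IH.
- elim/big_ind: _ => [|x z leax leay|i /set2P[] ->] //; last exact: ltnW.
  + exact: ltnW (ltn_ord a).
  + by rewrite leq_min leax.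
Qed.

Lemma emax_set2 k (a b : 'I_k) : a < b -> emax [set a; b] = b.
Proof.
move=> ltab; rewrite /emax; apply/eqP; rewrite eqn_leq; apply/andP; split.
- by apply/bigmax_leqP => i /set2P[] -> //; apply: ltnW.
- by apply: (@leq_bigmax_cond _ _ (fun i : 'I_k => i : nat)); rewrite set22.
Qed.

Lemma card2_ordP k (B : {set 'I_k}) :
  #|B| = 2 -> exists a b : 'I_k, a < b /\ B = [set a; b].
Proof.
move/eqP/cards2P=> [a [b [neq_ab ->]]].
have [ltab|ltba|eqab] := ltngtP a b; first by exists a, b.
- by exists b, a; rewrite setUC.
- by rewrite (val_inj eqab) eqxx in neq_ab.
Qed.

(** * The child construction and its inverse *)

Definition relabel k (y : 'I_k.+1) (i : 'I_k) : 'I_k.+2 := lift ord0 (lift y i).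

Definition new_edge k (y : 'I_k.+1) : {set 'I_k.+2} := [set ord0; lift ord0 y].

(** Convertible to [child] when [k] is [m.*2], since [m.+1.*2] reduces to [m.*2.+2]. *)
Definition extend k (M : {set {set 'I_k}}) (y : 'I_k.+1) : {set {set 'I_k.+2}} :=
  new_edge y |: [set relabel y @: (B : {set 'I_k}) | B in M].

Definition pairing k (M : {set {set 'I_k}}) : bool :=
  partition M [set: 'I_k] && [forall B in M, #|B| == 2].

Section Relabel.
Variables (k : nat) (y : 'I_k.+1).

Lemma relabelE (i : 'I_k) : relabel y i = (bump y i).+1 :> nat.
Proof. by []. Qed.

Lemma relabel_inj : injective (relabel y).
Proof. by move=> i j /lift_inj/lift_inj. Qed.

Lemma ltn_relabel (i j : 'I_k) : (relabel y i < relabel y j) = (i < j).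
Proof. rewrite !relabelE /bump; lia. Qed.

Lemma ord0_relabel (B : {set 'I_k}) : ord0 \notin relabel y @: B.
Proof. by apply/imsetP=> -[i _ /eqP]; rewrite (negbTE (neq_lift _ _)). Qed.

Lemma y_relabel (B : {set 'I_k}) : lift ord0 y \notin relabel y @: B.
Proof.
by apply/imsetP=> -[i _ /lift_inj/eqP]; rewrite (negbTE (neq_lift _ _)).
Qed.

Lemma relabelP (z : 'I_k.+2) : z \notin new_edge y -> exists i, z = relabel y i.
Proof.
rewrite !inE negb_or => /andP[]; case: (unliftP ord0 z) => [u ->|->] //.
rewrite (inj_eq lift_inj) => _; case: (unliftP y u) => [i ->|->] //.
by exists i.
by rewrite eqxx.
Qed.

Lemma new_edge_notin (M : {set {set 'I_k}}) :
  new_edge y \notin [set relabel y @: (B : {set 'I_k}) | B in M].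
Proof.
apply/imsetP=> -[B _ eqB]; have := ord0_relabel B.
by rewrite -eqB set21.
Qed.

End Relabel.

Lemma mem_extend0 k (M : {set {set 'I_k}}) y E :
  E \in extend M y -> ord0 \in E -> E = new_edge y.
Proof.
case/setU1P=> // /imsetP[B _ ->] B0; have := ord0_relabel y B; by rewrite B0.
Qed.

(** The edge containing [ord0] reveals [y]; deleting it leaves the relabeled edges, and relabeling
    is injective. *)
Lemma extend_inj k (M N : {set {set 'I_k}}) x y :
  extend M x = extend N y -> M = N /\ x = y.
Proof.
move=> eqMN.
have eq_new : new_edge x = new_edge y.
  apply: (@mem_extend0 _ N); last exact: set21.
  by rewrite -eqMN setU11.
have eqxy : x = y.
  have: lift ord0 x \in new_edge y by rewrite -eq_new set22.
  by case/set2P=> [/eqP|/lift_inj]; rewrite 1?eq_sym ?(negbTE (neq_lift _ _)).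
split=> //; subst y.
apply: (imset_inj (imset_inj (@relabel_inj _ x))).
have := congr1 (fun X => X :\ new_edge x) eqMN.
by rewrite !setU1K ?new_edge_notin.
Qed.

Lemma pairingP k (M : {set {set 'I_k}}) :
  reflect [/\ forall i, exists2 B, B \in M & i \in B,
              forall B C i, B \in M -> C \in M -> i \in B -> i \in C -> B = C
            & forall B, B \in M -> #|B| = 2] (pairing M).
Proof.
apply: (iffP andP) => [[/and3P[/eqP covM /trivIsetP trivM _] /forall_inP cardM]|].
  split=> [i|B C i MB MC iB iC|B /cardM/eqP] //.
  - have: i \in cover M by rewrite covM inE.
    by case/bigcupP=> B; exists B.
  - apply/eqP/idPn=> /(trivM _ _ MB MC)/pred0P/(_ i).
    by rewrite /= iB iC.
case=> covM uniqM cardM; split; last by apply/forall_inP=> B /cardM ->.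
apply/and3P; split.
- apply/eqP/setP=> i; rewrite inE; apply/bigcupP.
  by have [B MB iB] := covM i; exists B.
- apply/trivIsetP=> B C MB MC; apply: contraR => /pred0Pn[i /andP[iB iC]].
  by rewrite (uniqM B C i).
- by apply/negP=> /cardM; rewrite cards0.
Qed.

Lemma extend_pairing k (M : {set {set 'I_k}}) y :
  pairing M -> pairing (extend M y).
Proof.
case/pairingP=> covM uniqM cardM; apply/pairingP; split.
- move=> z; have [zn|/relabelP[i ->]] := boolP (z \in new_edge y).
    by exists (new_edge y); rewrite ?setU11.
  have [B MB iB] := covM i; exists (relabel y @: B); last exact: imset_f.
  by rewrite setU1r // imset_f.
- have disj (B : {set _}) z : z \in new_edge y -> z \in relabel y @: B -> False.
    by case/set2P=> ->; apply/negP; rewrite ?ord0_relabel ?y_relabel.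
  move=> _ _ z /setU1P[->|/imsetP[B MB ->]] /setU1P[->|/imsetP[C MC ->]] //.
  + by move=> /disj H /H.
  + by move=> H /disj /(_ H).
  + move=> /imsetP[i iB ->]; rewrite (mem_imset _ _ (@relabel_inj _ y)) => iC.
    by rewrite (uniqM B C i).
- move=> _ /setU1P[->|/imsetP[B MB ->]]; first by rewrite cards2 neq_lift.
  by rewrite (card_imset _ (@relabel_inj _ y)) cardM.
Qed.

(** The parent is found by deleting the edge at [ord0] and undoing the relabeling. *)
Lemma pairing_extendP k (N : {set {set 'I_k.+2}}) :
  pairing N -> exists2 M, pairing M & exists y, N = extend M y.
Proof.
case/pairingP=> covN uniqN cardN.
have [E0 NE0 E00] := covN ord0.
have [y E0E] : exists y, E0 = new_edge y.
  have [a [b [ltab E0E]]] := card2_ordP (cardN _ NE0); move: E00.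
  rewrite E0E => /set2P eq0.
  have a0 : a = ord0 by case: eq0 => // b0; move: ltab; rewrite -b0.
  case: (unliftP ord0 b) => [y ->|b0]; first by exists y; rewrite a0.
  by move: ltab; rewrite b0.
pose M := [set B : {set 'I_k} | relabel y @: B \in N].
(* Any other edge is disjoint from [E0], hence lies in the range of [relabel y] and is the image of
   its preimage. *)
have imE E : E \in N -> E != E0 -> exists2 B : {set 'I_k}, B \in M & E = relabel y @: B.
  move=> NE neqE.
  have EE : E = relabel y @: (relabel y @^-1: E).
    apply/setP=> z; apply/idP/imsetP=> [zE|[i]]; last by rewrite inE => ? ->.
    have [|i zi] := @relabelP _ y z; last by exists i; rewrite // inE -zi.
    by apply: contra neqE => zn; rewrite (uniqN E E0 z) // E0E.
  by exists (relabel y @^-1: E); rewrite // inE -EE.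
exists M.
  apply/pairingP; split.
  - move=> i; have [E NE iE] := covN (relabel y i).
    have [|B MB EB] := imE E NE.
      apply/eqP=> EE0; move: iE; rewrite EE0 E0E => iE.
      case/set2P: iE (ord0_relabel y [set i]) (y_relabel y [set i]) => <-;
        by rewrite imset_f ?set11.
    by exists B => //; move: iE; rewrite EB mem_imset //; apply: relabel_inj.
  - move=> B C i; rewrite !inE => NB NC iB iC.
    apply: (imset_inj (@relabel_inj _ y)).
    by apply: (uniqN _ _ (relabel y i)); rewrite ?imset_f.
  - move=> B; rewrite inE => /cardN.
    by rewrite (card_imset _ (@relabel_inj _ y)).
exists y; apply/setP=> E; apply/idP/idP=> [NE|/setU1P[->|/imsetP[B MB ->]]].
- have [->|/imE] := eqVneq E E0; first by rewrite E0E setU11.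
  by case=> // B MB ->; rewrite setU1r // imset_f.
- by rewrite -E0E.
- by move: MB; rewrite inE.
Qed.

(** * Crossings, nestings and closed edges of a child *)

(** For a pairing this is the [h j] of the overview: an edge lies inside the first [j] vertices when
    its larger end does. *)
Definition closed_before k (M : {set {set 'I_k}}) (j : nat) : nat :=
  #|[set B in M | emax B < j]|.

Section ExtendStats.
Variables (k : nat) (M : {set {set 'I_k}}) (y : 'I_k.+1).
Hypothesis pairM : pairing M.

Let cardM B : B \in M -> #|B| = 2.
Proof. by case/pairingP: pairM => _ _; apply. Qed.

Let imset_relabel_inj : injective (fun B : {set 'I_k} => relabel y @: B).
Proof. exact/imset_inj/relabel_inj. Qed.

Lemma emin_emax_relabel B : B \in M ->
  [/\ emin (relabel y @: B) = (bump y (emin B)).+1,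
      emax (relabel y @: B) = (bump y (emax B)).+1 & emin B < emax B].
Proof.
move/cardM/card2_ordP=> [a [b [ltab ->]]].
by rewrite imsetU1 imset_set1 !emin_set2 ?emax_set2 // ltn_relabel.
Qed.

Lemma emin_new_edge : emin (new_edge y) = 0.
Proof. by rewrite emin_set2. Qed.

Lemma emax_new_edge : emax (new_edge y) = y.+1.
Proof. by rewrite emax_set2. Qed.

Lemma card_relabeled (p : pred {set 'I_k.+2}) :
  #|[set E in [set relabel y @: (B : {set 'I_k}) | B in M] | p E]|
  = #|[set B : {set 'I_k} in M | p (relabel y @: B)]|.
Proof.
rewrite -[RHS](card_imset _ imset_relabel_inj); apply: eq_card => E.
rewrite inE; apply/andP/imsetP => [[/imsetP[B MB ->] pB]|[B]].
  by exists B; rewrite // inE MB.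
by rewrite inE => /andP[MB pB] ->; rewrite imset_f.
Qed.

Lemma pair_count_extend (r : rel {set 'I_k}) (r' : rel {set 'I_k.+2}) :
  symmetric r' -> irreflexive r' ->
  {in M &, forall A B : {set 'I_k}, r' (relabel y @: A) (relabel y @: B) = r A B} ->
  pair_count r' (extend M y) =
  pair_count r M + #|[set B : {set 'I_k} in M | r' (new_edge y) (relabel y @: B)]|.
Proof.
move=> r'C r'I rE; rewrite pair_count_setU1 ?new_edge_notin //.
by rewrite card_relabeled (pair_count_imset imset_relabel_inj rE).
Qed.

(** Starting at vertex 0, the new edge can only be the outer one of a nesting; it encloses the edges
    that end before its far end, those with [emax B < y] before relabeling. *)
Lemma nestings_extend :
  pair_count (@nesting _) (extend M y) =
  pair_count (@nesting _) M + closed_before M y.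
Proof.
rewrite (pair_count_extend (r := @nesting _)).
- congr (_ + _); apply: eq_card => B; rewrite !inE.
  case MB: (B \in M) => //=; have [e1 e2 lt12] := emin_emax_relabel MB.
  rewrite /nesting emin_new_edge emax_new_edge e1 e2 /bump; lia.
- exact: nesting_sym.
- exact: nesting_irr.
- move=> A B MA MB; have [a1 a2 lta] := emin_emax_relabel MA.
  have [b1 b2 ltb] := emin_emax_relabel MB.
  rewrite /nesting a1 a2 b1 b2 /bump; lia.
Qed.

(** Starting first, the new edge is crossed exactly by the edges with one end on each side of its
    far end. *)
Lemma crossings_extend :
  pair_count (@crossing _) (extend M y) =
  pair_count (@crossing _) M + #|[set B in M | emin B < y <= emax B]|.
Proof.
rewrite (pair_count_extend (r := @crossing _)).
- congr (_ + _); apply: eq_card => B; rewrite !inE.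
  case MB: (B \in M) => //=; have [e1 e2 lt12] := emin_emax_relabel MB.
  rewrite /crossing emin_new_edge emax_new_edge e1 e2 /bump; lia.
- exact: crossing_sym.
- exact: crossing_irr.
- move=> A B MA MB; have [a1 a2 lta] := emin_emax_relabel MA.
  have [b1 b2 ltb] := emin_emax_relabel MB.
  rewrite /crossing a1 a2 b1 b2 /bump; lia.
Qed.

(* y is the sum over the edges of the number of their ends among the first y
   vertices, and this number is odd exactly for the edges counted here. *)
Lemma odd_separating_edges :
  odd #|[set B in M | emin B < y <= emax B]| = odd y.
Proof.
have [/and3P[/eqP covM trivM _] _] := andP pairM.
have yE : (y : nat) = \sum_(B in M) \sum_(i in B | i < y) 1.
  rewrite -big_trivIset_cond // covM.
  rewrite (eq_bigl (fun i : 'I_k => i < y)); last by move=> i; rewrite inE.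
  have ley : y <= k by rewrite -ltnS.
  rewrite -(big_ord_widen_cond k xpredT (fun=> 1) ley).
  by rewrite sum1_card card_ord.
rewrite [in RHS]yE -sum1_card big_mkcond [X in _ = odd X]big_mkcond.
apply: (big_ind2 (fun a b => odd a = odd b)) => // [a b c d ab cd|B _].
  by rewrite !oddD ab cd.
rewrite inE; case MB: (B \in M) => //=.
have [a [b [ltab ->]]] := card2_ordP (cardM MB).
rewrite emin_set2 // emax_set2 //
big_mkcondr big_setU1 ?big_set1 /=; last first.
  by rewrite inE; apply: contraL ltab => /eqP ->; rewrite ltnn.
by case: (ltnP a y) => hay; case: (ltnP b y) => hby; rewrite ?andbF //=; lia.
Qed.

Lemma closed_before_extend j :
  closed_before (extend M y) j =
  (y.+1 < j) + #|[set B in M | (bump y (emax B)).+1 < j]|.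
Proof.
rewrite /closed_before /extend.
set I := [set relabel y @: (B : {set 'I_k}) | B in M].
have -> : #|[set B in M | (bump y (emax B)).+1 < j]| = #|[set E in I | emax E < j]|.
  rewrite card_relabeled; apply: eq_card => B; rewrite !inE.
  by case MB: (B \in M) => //=; have [_ ->] := emin_emax_relabel MB.
have [ltj|lej] /= := ltnP y.+1 j.
- transitivity #|new_edge y |: [set E in I | emax E < j]|; last first.
    by rewrite cardsU1 inE (negbTE (new_edge_notin _ _)).
  apply: eq_card => E; rewrite !inE.
  by have [->|] := eqVneq E; rewrite //= emax_new_edge ltj.
- apply: eq_card => E; rewrite !inE.
  have [->|] := eqVneq E; rewrite //= emax_new_edge ltnNge lej.
  by rewrite andbF.
Qed.

Lemma closed_before_extend0 : closed_before (extend M y) 0 = 0.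
Proof.
rewrite closed_before_extend /=; apply: eq_card0 => B.
by rewrite !inE andbF.
Qed.

(** The prefix of length [j.+1] misses the far end of the new edge. In the next lemma the prefix
    contains it, which closes one more edge. Both cover [j = y], so [closed_before M y] enters the
    child twice, once increased by one. *)
Lemma closed_before_extend_le j : j <= y ->
  closed_before (extend M y) j.+1 = closed_before M j.
Proof.
move=> lejy; rewrite closed_before_extend ltnS ltnNge lejy add0n.
by apply: eq_card => B; rewrite !inE /bump; congr andb; lia.
Qed.

Lemma closed_before_extend_ge j : y <= j ->
  closed_before (extend M y) j.+2 = (closed_before M j).+1.
Proof.
move=> leyj; rewrite closed_before_extend !ltnS leyj add1n.
by congr _.+1; apply: eq_card => B; rewrite !inE /bump; congr andb; lia.
Qed.

End ExtendStats.

(** * Matchings and generations of descendants *)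

Lemma mem_matchings n (M : edge_set n) : (M \in matchings n) = pairing M.
Proof. by rewrite inE. Qed.

Lemma matchings0 : matchings 0 = [set set0].
Proof.
apply/setP=> M; rewrite mem_matchings inE; apply/pairingP/eqP=> [[_ _ cardM]|->].
  apply/setP=> B; rewrite inE; apply/negP=> /cardM/card2_ordP[[]].
  by move=> i lti0; case: (notF lti0).
by split=> [[i lti0]|B C i|B]; [case: (notF lti0) | rewrite inE..].
Qed.

Lemma matchingsS n : matchings n.+1 = \bigcup_(N in matchings n) children N.
Proof.
apply/setP=> N; rewrite mem_matchings; apply/idP/bigcupP.
- case/pairing_extendP=> M pM [y ->]; exists M; first by rewrite mem_matchings.
  exact: (imset_f (child M)).
- case=> M; rewrite mem_matchings => pM /imsetP[y _ ->].
  exact: extend_pairing.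
Qed.

(** By [extend_inj] a child determines its parent and [y], so the union has no collisions and sets
    of descendants carry full multiplicity. *)
Lemma big_children (R : Type) (idx : R) (op : Monoid.com_law idx) m
    (A : {set edge_set m}) (F : edge_set m.+1 -> R) :
  \big[op/idx]_(P in \bigcup_(N in A) children N) F P =
  \big[op/idx]_(N in A) \big[op/idx]_(y < m.*2.+1) F (child N y).
Proof.
rewrite pair_big_dep /=.
pose h (p : edge_set m * 'I_m.*2.+1) : edge_set m.+1 := child p.1 p.2.
have -> : \bigcup_(N in A) children N = h @: [set p | p.1 \in A].
  apply/setP=> P; apply/bigcupP/imsetP=> [[N AN /imsetP[y _ ->]]|[[N y]]].
    by exists (N, y); rewrite ?inE.
  rewrite inE /= => AN ->; exists N => //; exact: imset_f.
rewrite big_imset /=.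
  by apply: eq_bigl => p; rewrite inE andbT.
by move=> [M x] [N y] _ _ /extend_inj[/= -> ->].
Qed.

Lemma descendants_matchings m (M : edge_set m) l P :
  M \in matchings m -> P \in descendants M l -> P \in matchings (l + m).
Proof.
move=> matM; elim: l P => [|l IHl] P /=; first by move=> /set1P ->.
case/bigcupP=> N /IHl matN PN.
change (P \in matchings (l + m).+1).
by rewrite matchingsS; apply/bigcupP; exists N.
Qed.

(** The size depends only on [m] and [l], so multisets of bits over descendants can be compared by
    their signed sums alone. *)
Lemma card_descendants m (M N : edge_set m) l :
  #|descendants M l| = #|descendants N l|.
Proof.
elim: l => [|l IHl] /=; first by rewrite !cards1.
by rewrite -!sum1_card !big_children !sum_nat_const IHl.
Qed.

(** * Signed sums and multisets of bits *)

Import GRing.Theory.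

Section SignedSums.
Local Open Scope ring_scope.

Definition signed (T : finType) (f : T -> nat) (A : {set T}) : int :=
  \sum_(x in A) (-1) ^+ f x.

Lemma count_bits (s : seq nat) : all (ltn^~ 2%N) s ->
  [/\ forall a, count a s = (a 0 * count_mem 0 s + a 1 * count_mem 1 s)%N,
      size s = (count_mem 0 s + count_mem 1 s)%N
    & \sum_(i <- s) (-1) ^+ i = (count_mem 0%N s)%:Z - (count_mem 1%N s)%:Z].
Proof.
elim: s => [_|b s IHs] /=; first by rewrite big_nil; split=> // a; rewrite !muln0.
case/andP=> b2 /IHs[IHa IHz IHb]; rewrite big_cons IHb IHz.
move: {IHs IHz IHb} (count_mem 0%N s) (count_mem 1%N s) IHa => c0 c1 IHa.
case: b b2 => [|[|//]] _ /=; split=> [a||]; rewrite ?IHa ?expr0 ?expr1.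
- by rewrite add0n mulnDr muln1 addnA.
- by rewrite add0n addSn.
- by rewrite add0n PoszD addrA.
- by rewrite add0n mulnDr muln1 addnCA.
- by rewrite add0n addnS.
- by rewrite add0n PoszD opprD addrCA.
Qed.

(** The size is the sum of the numbers of zeros and ones, the signed sum their difference; together
    they determine both. *)
Lemma perm_eq_bits (s t : seq nat) :
  all (ltn^~ 2%N) s -> all (ltn^~ 2%N) t -> size s = size t ->
  perm_eq s t <-> \sum_(i <- s) (-1) ^+ i = \sum_(i <- t) (-1) ^+ i :> int.
Proof.
move=> s2 t2 eqz; split=> [st|]; first exact: perm_big.
have [sa sz ->] := count_bits s2; have [ta tz ->] := count_bits t2.
move=> eqst; apply/permP=> a; rewrite sa ta.
have -> : count_mem 0%N s = count_mem 0%N t by lia.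
by have -> : count_mem 1%N s = count_mem 1%N t by lia.
Qed.

Lemma perm_eq_mod2 (T : finType) (f : T -> nat) (A B : {set T}) : #|A| = #|B| ->
  perm_eq [seq (f x %% 2)%N | x in A] [seq (f x %% 2)%N | x in B]
  <-> signed f A = signed f B.
Proof.
have bits (C : {set T}) : all (ltn^~ 2%N) [seq (f x %% 2)%N | x in C].
  by apply/allP=> _ /imageP[x _ ->]; rewrite /= ltn_mod.
have sumE (C : {set T}) :
    \sum_(i <- [seq (f x %% 2)%N | x in C]) (-1) ^+ i = signed f C.
  rewrite big_map big_enum; apply: eq_bigr => x _.
  by rewrite modn2 signr_odd.
move=> eqAB; rewrite -!sumE; apply: perm_eq_bits => //.
by rewrite !size_map -!cardE.
Qed.

Lemma signedE (T : finType) (f : T -> nat) (A : {set T}) :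
  signed f A = #|A|%:Z - (2 * #|[set x in A | odd (f x)]|)%N%:Z.
Proof.
have -> : #|[set x in A | odd (f x)]| = (\sum_(x in A) odd (f x))%N.
  rewrite -sum1_card big_mkcond [RHS]big_mkcond; apply: eq_bigr => x _.
  by rewrite inE; case: (x \in A) => //=; case: odd.
have -> : #|A| = (\sum_(x in A) 1)%N by rewrite sum1_card.
rewrite /signed PoszM.
elim/big_rec3: _ => // x a b c _ ->.
rewrite -signr_odd; case: (odd (f x)) => /=; rewrite ?expr0 ?expr1 ?add0n ?PoszD; ring.
Qed.

(** * Signed sums of crossings *)

Lemma alternating_sum m : \sum_(y < m.*2.+1) (-1) ^+ y = 1%R :> int.
Proof.
elim: m => [|m IHm]; first by rewrite big_ord_recl big_ord0.
rewrite doubleS big_ord_recr big_ord_recr /= IHm.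
rewrite -signr_odd /= odd_double -[X in _ + X]signr_odd /= odd_double.
by rewrite expr1 expr0 addrNK.
Qed.

Lemma signed_cr_children m (M : edge_set m) : M \in matchings m ->
  \sum_(y < m.*2.+1) (-1) ^+ cr (child M y) = (-1) ^+ cr M :> int.
Proof.
rewrite mem_matchings => pM.
transitivity ((-1) ^+ cr M * \sum_(y < m.*2.+1) (-1) ^+ y : int); last first.
  by rewrite alternating_sum mulr1.
rewrite mulr_sumr; apply: eq_bigr => y _.
have -> : cr (child M y) = _ := crossings_extend y pM.
by rewrite exprD -[X in _ * X]signr_odd odd_separating_edges // signr_odd.
Qed.

Lemma signed_cr_descendants m (M : edge_set m) l : M \in matchings m ->
  signed (@cr _) (descendants M l) = (-1) ^+ cr M.
Proof.
move=> matM; elim: l => [|l IHl] /=; first by rewrite /signed big_set1.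
rewrite -IHl /signed big_children; apply: eq_bigr => N descN.
exact/signed_cr_children/(descendants_matchings matM descN).
Qed.

(** Generation 0 already shows the parity of [cr], and the signed sums of all generations depend on
    nothing else. *)
Lemma cr2_equivP m (M N : edge_set m) : M \in matchings m -> N \in matchings m ->
  cr2_equiv M N <-> odd (cr M) = odd (cr N).
Proof.
move=> matM matN; split=> [/(_ 0%N)|eqMN l].
  move/(perm_eq_mod2 (@cr (0 + m)) (card_descendants M N 0)).
  rewrite !signed_cr_descendants //.
  by rewrite -signr_odd -[RHS]signr_odd; case: odd; case: odd.
apply/(perm_eq_mod2 (@cr (l + m)) (card_descendants M N l)).
by rewrite !signed_cr_descendants // -signr_odd eqMN signr_odd.
Qed.

Lemma card_matchings n : #|matchings n| = odd_dfact n.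
Proof.
elim: n => [|n IHn]; first by rewrite matchings0 cards1 /odd_dfact big_ord0.
rewrite /odd_dfact big_ord_recr /= -/(odd_dfact n) -IHn matchingsS.
rewrite -[LHS]sum1_card big_children -sum_nat_const; apply: eq_bigr => N _.
by rewrite sum1_card card_ord mul2n addn1.
Qed.

(** All matchings descend from the empty one, whose sign is 1, and each generation keeps the signed
    sum. *)
Lemma signed_cr_matchings n : signed (@cr n) (matchings n) = 1.
Proof.
elim: n => [|n IHn].
  rewrite matchings0 /signed big_set1.
  by have -> : @cr 0 set0 = 0%N := pair_count_set0 _.
rewrite matchingsS /signed big_children -[RHS]IHn.
by apply: eq_bigr => N; apply: signed_cr_children.
Qed.

Lemma card_odd_cr n :
  (2 * #|[set M in matchings n | odd (cr M)]| + 1)%N = odd_dfact n.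
Proof.
have := signed_cr_matchings n; rewrite signedE card_matchings.
by move/eqP; rewrite subr_eq => /eqP; rewrite -PoszD addnC => -[->].
Qed.

(** * Signed sums of nestings *)

Lemma signed_ne_children m (M : edge_set m) : M \in matchings m ->
  \sum_(y < m.*2.+1) (-1) ^+ ne (child M y)
  = (-1) ^+ ne M * \sum_(y < m.*2.+1) (-1) ^+ closed_before M y :> int.
Proof.
rewrite mem_matchings => pM; rewrite mulr_sumr; apply: eq_bigr => y _.
have -> : ne (child M y) = _ := nestings_extend y pM.
by rewrite exprD.
Qed.

(** The 1 comes from the empty prefix, the first sum from the other prefixes that miss the far end
    of the new edge, the second from those containing it. *)
Lemma sum_closed_before_child m (M : edge_set m) (y : 'I_m.*2.+1) :
  M \in matchings m ->
  \sum_(z < m.+1.*2.+1) (-1) ^+ closed_before (child M y) z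
  = 1 + \sum_(j < m.*2.+1 | (j <= y)%N) (-1) ^+ closed_before M j
    - \sum_(j < m.*2.+1 | (y <= j)%N) (-1) ^+ closed_before M j :> int.
Proof.
rewrite mem_matchings => pM.
pose F z : int := (-1) ^+ closed_before (child M y) z.
rewrite -(big_mkord xpredT F) doubleS big_nat_recl //.
have -> : F 0%N = 1 by rewrite /F [closed_before _ _](closed_before_extend0 y pM).
rewrite -addrA; congr (_ + _).
(* After the shift by one, an index up to [y] stands for [j] and a larger one for [j.+1], hence the
   cut at [y.+1]. *)
rewrite (@big_cat_nat _ _ _ y.+1) //=; last exact: leqW.
congr (_ + _).
- rewrite big_mkord (big_ord_widen_cond m.*2.+1 xpredT (fun j => F j.+1)) //=.
  apply: eq_big => [j|j lejy]; first by rewrite ltnS.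
  by rewrite /F; have -> : closed_before (child M y) j.+1 = _
    := closed_before_extend_le pM lejy.
- rewrite big_add1 /= -sumrN -(big_mkord (fun j => (y <= j)%N)
    (fun j => - (-1) ^+ closed_before M j)) big_nat_cond.
  rewrite [RHS](@big_cat_nat _ _ _ y) ?(ltnW (ltn_ord y)) //=.
  rewrite [X in _ = X + _]big_nat_cond [X in _ = X + _]big_pred0 ?add0r; last first.
    by move=> j; lia.
  rewrite [RHS]big_nat_cond; apply: eq_big => [j|j /andP[/andP[leyj _] _]].
    by lia.
  rewrite /F; have -> : closed_before (child M y) j.+2 = _
    := closed_before_extend_ge pM leyj.
  by rewrite exprS mulN1r.
Qed.

(** Swapping [x] and [j] turns one double sum into the other, so they cancel, diagonal included. *)
Lemma symmetric_double_sum (R : comNzRingType) n (s : 'I_n -> R) :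
  \sum_x s x * (1 + \sum_(j < n | (j <= x)%N) s j - \sum_(j < n | (x <= j)%N) s j)
  = \sum_x s x.
Proof.
rewrite (eq_bigr (fun x : 'I_n => s x + (\sum_(j < n | (j <= x)%N) s x * s j
                                  - \sum_(j < n | (x <= j)%N) s x * s j))).
  rewrite big_split /= sumrB (exchange_big_dep xpredT) //=.
  rewrite [X in _ + (X - _)](eq_bigr (fun x : 'I_n => \sum_(j < n | (x <= j)%N) s x * s j)).
    by rewrite subrr addr0.
  by move=> x _; apply: eq_bigr => j _; rewrite mulrC.
by move=> x _; rewrite -addrA mulrDr mulr1 mulrBr !mulr_sumr.
Qed.

Definition sign_total m (M : edge_set m) : int :=
  \sum_(y < m.*2.+1) (-1) ^+ closed_before M y.

Lemma signed_ne_grandchildren m (M : edge_set m) : M \in matchings m ->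
  \sum_(y < m.*2.+1) (-1) ^+ ne (child M y) * sign_total (child M y)
  = (-1) ^+ ne M * sign_total M.
Proof.
(* The total of [M] is expanded backwards by the double sum identity, so that both sides agree term
   by term. *)
move=> matM; rewrite /sign_total -[X in _ = _ * X]symmetric_double_sum [RHS]mulr_sumr.
apply: eq_bigr => y _; rewrite sum_closed_before_child // mulrA.
have -> : ne (child M y) = _ := nestings_extend y (etrans (esym (mem_matchings M)) matM).
by rewrite exprD.
Qed.

(** Generation 0 is left out: its signed sum is the sign of [M] without the factor
    [sign_total M]. *)
Lemma signed_ne_descendants m (M : edge_set m) l : M \in matchings m ->
  signed (@ne _) (descendants M l.+1) = (-1) ^+ ne M * sign_total M.
Proof.
move=> matM.
have stepE k : signed (@ne _) (descendants M k.+1)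
    = \sum_(N in descendants M k) (-1) ^+ ne N * sign_total N.
  rewrite /signed big_children; apply: eq_bigr => N descN.
  exact/signed_ne_children/(descendants_matchings matM descN).
elim: l => [|l IHl]; first by rewrite stepE /= big_set1.
rewrite -IHl 2!stepE /= big_children; apply: eq_bigr => N descN.
exact/signed_ne_grandchildren/(descendants_matchings matM descN).
Qed.

(** Generation 0 gives the parity of [ne]; cancelling this common sign in generation 1 gives
    [sign_total]; later generations tell no more. *)
Lemma ne2_equivP m (M N : edge_set m) : M \in matchings m -> N \in matchings m ->
  ne2_equiv M N <-> odd (ne M) = odd (ne N) /\ sign_total M = sign_total N.
Proof.
move=> matM matN; split=> [eqMN|[eqo eqt] l].
  have eqo : odd (ne M) = odd (ne N).
    have /(perm_eq_mod2 (@ne (0 + m)) (card_descendants M N 0)) := eqMN 0%N.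
    rewrite /signed /= !big_set1 -signr_odd -[RHS]signr_odd.
    by case: odd; case: odd.
  split=> //.
  have /(perm_eq_mod2 (@ne (1 + m)) (card_descendants M N 1)) := eqMN 1%N.
  rewrite !signed_ne_descendants // -signr_odd eqo signr_odd.
  by apply: mulfI; rewrite signr_eq0.
apply/(perm_eq_mod2 (@ne (l + m)) (card_descendants M N l)).
case: l => [|l]; last first.
  by rewrite !signed_ne_descendants // -signr_odd eqo signr_odd eqt.
by rewrite /signed /= !big_set1 -signr_odd eqo signr_odd.
Qed.

End SignedSums.

(** * Classes as fibres of an invariant *)

(** [f] is a complete invariant and [L] lists its values, so the classes are its nonempty fibres,
    indexed by [L]. *)
Lemma card_classes (T : finType) (K : eqType) (f : T -> K) (R : rel T)
    (D : {set T}) (L : seq K) :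
  {in D &, forall x y, R x y = (f x == f y)} -> uniq L ->
  (forall v, v \in L <-> exists2 x, x \in D & f x = v) ->
  #|equivalence_partition R D| = size L.
Proof.
move=> RE uniqL memL; pose fiber v := [set x in D | f x == v].
have fiber_inj : {in L &, injective fiber}.
  move=> u v /memL[x Dx <-] _ /setP/(_ x).
  by rewrite !inE Dx eqxx => /esym/eqP.
rewrite -(size_map fiber) -(card_uniqP _); last by rewrite map_inj_in_uniq.
apply: eq_card => X; apply/imsetP/mapP=> [[x Dx ->]|[v /memL[x Dx <-] ->]].
  exists (f x); first by apply/memL; exists x.
  by apply/setP=> y; rewrite !inE; case Dy: (y \in D); rewrite // RE // eq_sym.
exists x => //; apply/setP=> y; rewrite !inE.
by case Dy: (y \in D); rewrite // RE // eq_sym.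
Qed.

Lemma cr2_classesE n :
  cr2_classes n =
  equivalence_partition (fun M N : edge_set n => odd (cr M) == odd (cr N)) (matchings n).
Proof.
apply: eq_in_imset => M matM; apply/setP=> N; rewrite !inE.
have [matN|//] := boolP (partition N _ && _).
have {}matN : N \in matchings n by rewrite inE.
by apply/asboolP/eqP; rewrite cr2_equivP.
Qed.

(** * Sign sequences and their changes *)

Fixpoint changes (b : bool) (w : seq bool) : nat :=
  if w is a :: w' then (a != b) + changes a w' else 0.

Lemma changes_cat b u v : changes b (u ++ v) = changes b u + changes (last b u) v.
Proof. by elim: u b => //= a u IHu b; rewrite IHu addnA. Qed.

Lemma changes_negb b w : changes (~~ b) (map negb w) = changes b w.
Proof. by elim: w b => //= a w IHw b; rewrite IHw; case: a b => [] []. Qed.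

Lemma last_changes b w : last b w = b (+) odd (changes b w).
Proof.
elim: w b => [|a w IHw] b /=; rewrite ?addbF // IHw oddD.
by case: a b => [] [] /=; case: odd.
Qed.

(** Odd-numbered changes lead to the sign other than [b], even-numbered ones back to [b], and each
    change lands on an entry of its own. *)
Lemma count_changes b w :
  uphalf (changes b w) <= count (predC1 b) w /\ (changes b w)./2 <= count_mem b w.
Proof.
elim: w b => //= a w IHw b; case: (IHw a) => {IHw}.
have eT : count (predC1 true) w = count_mem false w by apply: eq_count => -[].
have eF : count (predC1 false) w = count_mem true w by apply: eq_count => -[].
by case: a b => [] []; rewrite ?eT ?eF /=; lia.
Qed.

(* A state is the parity of ne with the sign sequence, [true] standing for -1. *)
Definition step (s : bool * seq bool) (x : nat) : bool * seq bool :=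
  (s.1 (+) nth false s.2 x, false :: take x.+1 s.2 ++ map negb (drop x s.2)).

(** A computable list of the states of all matchings, repetitions allowed, grown from the empty
    matching; small cases are settled by evaluating it. *)
Fixpoint reach (n : nat) : seq (bool * seq bool) :=
  if n is n'.+1 then [seq step s x | s <- reach n', x <- iota 0 n'.*2.+1]
  else [:: (false, [:: false])].

Definition profile m (M : edge_set m) : bool * seq bool :=
  (odd (ne M), mkseq (fun j => odd (closed_before M j)) m.*2.+1).

Lemma profile_child m (M : edge_set m) (y : 'I_m.*2.+1) :
  M \in matchings m -> profile (child M y) = step (profile M) y.
Proof.
rewrite mem_matchings => pM; rewrite /profile /step.
set w := mkseq (fun j => odd (closed_before M j)) _.
have sw : size w = m.*2.+1 by rewrite size_mkseq.
have wE i : i < m.*2.+1 -> nth false w i = odd (closed_before M i).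
  exact: nth_mkseq.
clearbody w; have lty := ltn_ord y; rewrite /= wE //.
rewrite [ne (child M y)](nestings_extend y pM) oddD; congr pair.
set u := take y.+1 w.
have su : size u = y.+1 by rewrite size_takel ?sw.
have uE i : i <= y -> nth false u i = nth false w i by move=> leiy; apply: nth_take.
clearbody u; apply: (@eq_from_nth _ false) => [|i].
  by rewrite size_mkseq /= size_cat su size_map size_drop sw; lia.
rewrite size_mkseq => lti; rewrite nth_mkseq //.
(* Position 0 is the empty prefix; positions up to [y.+1] come from [take], the others from the
   negated [drop], which reads index [y] a second time. *)
case: i lti => [|i] lti /=; first by rewrite [closed_before _ _](closed_before_extend0 y pM).
rewrite nth_cat su ltnS; have [leiy|ltyi] := leqP i y.
  rewrite uE // wE; last exact: leq_ltn_trans leiy _.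
  by rewrite [closed_before _ _](closed_before_extend_le pM leiy).
case: i lti ltyi => // i lti; rewrite ltnS => leyi.
have lti' : i < m.*2.+1 by move: lti; rewrite doubleS !ltnS.
rewrite [closed_before _ _](closed_before_extend_ge pM leyi) subSS.
rewrite (nth_map false) ?size_drop ?sw; last by lia.
by rewrite nth_drop subnKC // wE.
Qed.

Lemma mem_reach n v :
  v \in reach n <-> exists2 M : edge_set n, M \in matchings n & profile M = v.
Proof.
elim: n v => [|n IHn] v.
  have prof0 : profile (set0 : edge_set 0) = (false, [:: false]).
    rewrite /profile [ne _]pair_count_set0 /mkseq /=.
    by rewrite /closed_before (eq_card0 (A := [set _ in _ | _])) // => B; rewrite !inE.
  rewrite inE; split=> [/eqP ->|[M]].
    by exists set0; rewrite // matchings0 set11.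
  by rewrite matchings0 => /set1P -> <-; rewrite prof0.
split.
  case/allpairsP=> -[s x] [/IHn[M matM eqs]].
  rewrite mem_iota add0n /= => ltx ->; move: eqs => /= <-.
  exists (child M (Ordinal ltx)); last by rewrite profile_child.
  by rewrite matchingsS; apply/bigcupP; exists M => //; apply: imset_f.
case=> P; rewrite matchingsS => /bigcupP[M matM /imsetP[y _ ->]] <-.
rewrite profile_child //; apply: allpairs_f; first by apply/IHn; exists M.
by rewrite mem_iota /=.
Qed.

(** * The complete invariant for nestings and its values *)

Definition key m (M : edge_set m) : bool * nat :=
  ((profile M).1, count id (profile M).2).

Definition keys (n : nat) : seq (bool * nat) :=
  [seq (s.1, count id s.2) | s <- reach n].

Lemma mem_keys n v :
  v \in keys n <-> exists2 M : edge_set n, M \in matchings n & key M = v.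
Proof.
split=> [/mapP[s /mem_reach[M matM <-] ->]|[M matM <-]]; first by exists M.
by apply/mapP; exists (profile M) => //; apply/mem_reach; exists M.
Qed.

(** Each minus sign lowers the total by 2, so equal totals mean equal numbers of minus signs, as
    recorded in [key]. *)
Lemma sign_totalE m (M : edge_set m) :
  sign_total M = (m.*2.+1%:Z - (2 * count id (profile M).2)%:Z)%R.
Proof.
rewrite /sign_total -[(profile M).2]/(mkseq _ _) count_map.
have -> : count (preim (fun j => odd (closed_before M j)) id) (iota 0 m.*2.+1)
    = #|[set j in [set: 'I_m.*2.+1] | odd (closed_before M j)]|.
  rewrite cardsE -sum1_card -sum1_count -[iota _ _]/(index_iota 0 m.*2.+1) big_mkord.
  by apply: eq_bigl => j; rewrite unfold_in in_setT.
have := signedE (fun j : 'I_m.*2.+1 => closed_before M j) setT.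
rewrite cardsT card_ord => <-.
by apply: eq_bigl => j; rewrite inE.
Qed.

Lemma card_ne2_classes n (L : seq (bool * nat)) :
  uniq L -> keys n =i L -> #|ne2_classes n| = size L.
Proof.
move=> uniqL keysL; apply: (card_classes (f := @key n)) => // [M N matM matN|v].
  apply/asboolP/eqP; rewrite ne2_equivP // !sign_totalE.
    move=> [eqo eqt]; congr pair; first exact: eqo.
    by move: eqt => /addrI/oppr_inj[] /eqP; rewrite eqn_pmul2l // => /eqP.
  move=> eqk; split; first exact: (congr1 fst eqk).
  have eqc : count id (profile M).2 = count id (profile N).2 := congr1 snd eqk.
  by rewrite eqc.
by rewrite -keysL mem_keys.
Qed.

(** A step repeats entry [x] with the opposite sign, which adds one change; negating the tail keeps
    its changes, and the prefixed plus meets a plus, the first sign of the parent. *)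
Lemma reach_invariant n s : s \in reach n ->
  [/\ exists w, s.2 = false :: w, 0 < n -> exists w, s.2 = [:: false, false & w],
      size s.2 = n.*2.+1 & changes false s.2 = n].
Proof.
elim: n s => [|n IHn] s; first by rewrite inE => /eqP -> /=; split=> //; exists [::].
case/allpairsP=> -[[e w] x] [/IHn]; rewrite mem_iota add0n.
case=> -[w' /= wE] _ sw cw ltx ->; split=> /=.
- by eexists.
- by move=> _; rewrite wE /=; eexists.
- rewrite size_cat size_takel ?sw // size_map size_drop sw; lia.
- have [dE tE] : drop x w = nth false w x :: drop x.+1 w
      /\ take x.+1 w = rcons (take x w) (nth false w x).
    by rewrite (drop_nth false) ?sw // (take_nth false) ?sw.
  rewrite changes_cat dE map_cons /= {1 2}tE last_rcons.
  have -> : changes (~~ nth false w x) (map negb (drop x.+1 w))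
      = changes (nth false w x) (drop x.+1 w) by apply: changes_negb.
  move: cw; rewrite -{1}(cat_take_drop x.+1 w) changes_cat tE last_rcons.
  by case: (nth _ _ _) => /=; lia.
Qed.

(** After two plus signs there remain [2n - 1] entries with [n] changes, of which at least
    [uphalf n] are minus and at least [n./2] plus. *)
Lemma reach_count n s : 0 < n -> s \in reach n ->
  uphalf n <= count id s.2 < uphalf n + n.
Proof.
case: s => e w n_gt0 /reach_invariant /= [_ /(_ n_gt0)[w' wE] sw cw].
have [] := count_changes false w'; have := count_predC id w'.
rewrite (@eq_count _ (predC1 _) id); last by case.
rewrite (@eq_count _ (predC id) (pred1 false)); last by case.
move: sw cw; rewrite wE /=; lia.
Qed.

Lemma key_step n s x : s \in reach n -> x < n.*2.+1 ->
  ((step s x).1, count id (step s x).2) \in keys n.+1.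
Proof.
move=> ns ltx; apply/mapP; exists (step s x) => //.
by apply: allpairs_f; rewrite // mem_iota.
Qed.

(* Joining the new vertex to the very end keeps the excess t of the number of
   minus signs over its minimum; joining it to the very beginning turns t into
   n - t. *)
Lemma keys_surj n e t : 2 < n -> t < n -> (e, uphalf n + t) \in keys n.
Proof.
elim: n e t => // n IHn e t; rewrite ltnS leq_eqVlt => /orP[/eqP <-|n3] ltt.
  (* For three edges all six keys are found by evaluation. *)
  by case: e t ltt => [] [|[|[|]]] //.
have [ltn|] := ltnP t n.
  (* After [n] changes from plus the last sign is [odd n]. Joining to the end adds it to the parity,
     which [e (+) odd n] compensates. *)
  have /mapP[[e' w] rs [eqe eqc]] := IHn (e (+) odd n) t n3 ltn.
  have [[w' /= wE] _ /= sw cw] := reach_invariant rs.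
  have := key_step rs (ltnSn n.*2).
  have lastE : nth false w n.*2 = odd n.
    by have := last_changes false w; rewrite cw -nth_last sw.
  have takeE : take n.*2.+1 w = w by rewrite -sw take_size.
  have dropE : drop n.*2 w = [:: odd n].
    by rewrite (drop_nth false) ?sw // -[in drop _ _]sw drop_size lastE.
  rewrite /step /fst /snd takeE dropE lastE /= count_cat /= -eqc -eqe addbK.
  suff -> : uphalf n + t + (~~ odd n + 0) = uphalf n.+1 + t by [].
  by rewrite /= -[X in uphalf X]odd_double_half; lia.
move=> len; have {len ltt} -> : t = n by lia.
(* The remaining case [t = n] comes from excess 0 by [x = 0]; the parity is kept because the first
   sign is plus. *)
have /mapP[[e' w] rs [-> eqc]] := IHn e 0 n3 (ltnW (ltnW n3)).
have [[w' /= wE] _ /= sw cw] := reach_invariant rs.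
have := key_step rs (ltn0Sn n.*2).
have := count_predC id w; rewrite sw -eqc => cE.
rewrite /step /fst /snd drop0 wE /= take0 /= addbF.
suff -> : 0 + (0 + (1 + count id (map negb w'))) = uphalf n.+1 + n by [].
have -> : count id (map negb w') = count (predC id) w' by rewrite count_map.
by move: cE; rewrite wE /=; lia.
Qed.

Lemma keysE n : 2 < n ->
  keys n =i [seq (e, uphalf n + t) | e <- [:: false; true], t <- iota 0 n].
Proof.
move=> n3 v; apply/idP/allpairsP=> [/mapP[s rs ->]|[[e t] /= [_]]].
  have /andP[lo hi] := reach_count (ltnW (ltnW n3)) rs.
  exists (s.1, count id s.2 - uphalf n); split=> /=; first by case: s.1.
  - by rewrite mem_iota add0n /= ltn_subLR.
  - by rewrite subnKC.
by rewrite mem_iota => /andP[_ ltt] ->; apply: keys_surj.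
Qed.

(** * Numbers and sizes of the classes *)

Theorem theorem4p4 :
  [/\ #|cr2_classes 1| = 1
        /\ (forall n : nat, 2 <= n -> #|cr2_classes n| = 2),
      (forall n : nat, 2 <= n ->
         exists C D : {set edge_set n},
           [/\ cr2_classes n = [set C; D], C <> D,
               #|C| = (odd_dfact n + 1) %/ 2
             & #|D| = (odd_dfact n - 1) %/ 2]),
      #|ne2_classes 1| = 1,
      #|ne2_classes 2| = 3
    & forall n : nat, 3 <= n -> #|ne2_classes n| = 2 * n].
Proof.
have two_classes n : 2 <= n ->
    exists C D : {set edge_set n},
      [/\ cr2_classes n = [set C; D], C <> D,
          #|C| = (odd_dfact n + 1) %/ 2 & #|D| = (odd_dfact n - 1) %/ 2].
  move=> n2; pose fiber b := [set M in matchings n | odd (cr M) == b].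
  have odd_fiber : 2 * #|fiber true| + 1 = odd_dfact n.
    rewrite -card_odd_cr; congr (2 * _ + 1); apply: eq_card => M.
    by rewrite !inE eqb_id.
  have even_fiber : #|fiber false| + #|fiber true| = odd_dfact n.
    rewrite -card_matchings -(cardsID [set M | odd (cr M)] (matchings n)) addnC.
    by congr (_ + _); apply: eq_card => M; rewrite !inE ?eqb_id ?eqbF_neg 1?andbC.
  (* The fibre sizes differ by one, so with at least three matchings both parities occur. *)
  have dfact3 : 3 <= odd_dfact n.
    case: n n2 {fiber odd_fiber even_fiber} => [|[|n]] // _.
    rewrite /odd_dfact big_ord_recl big_ord_recl /= mulnA.
    by rewrite leq_pmulr // prodn_gt0.
  have ex b : exists2 M, M \in matchings n & odd (cr M) = b.
    have: 0 < #|fiber b| by case: b; lia.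
    by case/card_gt0P=> M; rewrite inE => /andP[matM /eqP]; exists M.
  exists (fiber false), (fiber true); split; try lia.
  - rewrite cr2_classesE; apply/setP=> X; apply/imsetP/set2P=> [[M matM ->]|].
      have -> : [set N in matchings n | odd (cr M) == odd (cr N)]
          = fiber (odd (cr M)) by apply/setP=> N; rewrite !inE eq_sym.
      by case: odd; [right | left].
    have fiberE b : exists2 M, M \in matchings n &
        fiber b = [set N in matchings n | odd (cr M) == odd (cr N)].
      have [M matM <-] := ex b; exists M => //.
      by apply/setP=> N; rewrite !inE eq_sym.
    by case=> ->; apply: fiberE.
  - by move=> eqf; move: odd_fiber even_fiber; rewrite eqf; lia.
split=> //.
- split=> [|n /two_classes[C [D [-> /eqP neqCD _ _]]]]; last by rewrite cards2 neqCD.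
  rewrite cr2_classesE.
  apply: (@card_classes _ _ (fun M : edge_set 1 => odd (cr M)) _ _ [:: false]) => // v.
  (* The only matching for [n = 1] must be even, as twice the number of odd ones plus 1 is 1. *)
  have /eqP: #|[set M in matchings 1 | odd (cr M)]| = 0.
    by have := card_odd_cr 1; rewrite /odd_dfact big_ord_recl big_ord0 /=; lia.
  rewrite cards_eq0 => /eqP/setP even1.
  have evenM M : M \in matchings 1 -> odd (cr M) = false.
    by move=> matM; have := even1 M; rewrite in_set0 inE matM.
  rewrite inE; split=> [/eqP ->|[M /evenM -> <-]] //.
  have: 0 < #|matchings 1| by rewrite card_matchings /odd_dfact big_ord_recl big_ord0.
  by case/card_gt0P=> M matM; exists M; rewrite ?evenM.
- by rewrite (@card_ne2_classes 1 [:: (false, 1)]).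
(* Evaluation leaves [(false, 1)], [(false, 2)] and [(true, 1)]; of the four pairs within the
   bounds, [(true, 2)] does not occur. *)
- have keys2 : keys 2 =i undup (keys 2) by move=> v; rewrite mem_undup.
  by rewrite (card_ne2_classes (undup_uniq _) keys2).
- move=> n n3; rewrite (card_ne2_classes _ (keysE n3)).
    by rewrite size_allpairs size_iota.
  apply: allpairs_uniq; rewrite ?iota_uniq // => -[e t] [e' t'] _ _ [-> /addnI ->].
  by [].
Qed.
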